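(* Let $X$ be a real Banach space, let $(\Omega,\Sigma,\mu)$ be a measure space with $\mu(\Omega)<\infty$, and let $F:\Omega\to BC(X)$ be a Bochner integrable multifunction with $$\int_\Omega F\,d\mu=\{0\}.$$ Then for almost all $t\in\Omega$ the set $F(t)$ contains only one point.
   Context: $\rho_H$ is the Hausdorff distance, $\rho_H(A,B)=\max\{\sup_{b\in B}\inf_{a\in A}\|a-b\|,\ \sup_{a\in A}\inf_{b\in B}\|a-b\|\}$. $BC(X)$ is the set of all nonempty bounded convex subsets of $X$, where sets $A,B$ with $\rho_H(A,B)=0$ (equivalently, with the same closure) are identified; it is a metric space under $\rho_H$. $Z(X)$ is the Banach space of bounded continuous real functions on the unit sphere $S_{X^*}$ of the dual, with the sup norm. The Rådström embedding $R:BC(X)\to Z(X)$ is $(R(A))(x^* )=\sup_{a\in A}x^*(a)$. A multifunction $F:\Omega\to BC(X)$ is Bochner integrable with $\int_\Omega F\,d\mu=A\in BC(X)$ if the vector-valued function $R\circ F:\Omega\to Z(X)$ is Bochner integrable with $\int_\Omega R\circ F\,d\mu=R(A)$. *)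

(* Defs.v *)
From HB Require Import structures.
From mathcomp Require Import all_boot all_order all_algebra generic_quotient.
From mathcomp Require Import all_classical all_reals all_analysis.
From mathcomp Require Import lra.

Set Implicit Arguments.
Unset Strict Implicit.
Unset Printing Implicit Defensive.

Import Order.TTheory GRing.Theory Num.Theory.
Import numFieldNormedType.Exports.

Local Open Scope classical_set_scope.
Local Open Scope ring_scope.

Section supnorm.
Variables (R : realType) (I : Type) (D : set I).
Implicit Types f g : I -> R.

(* sup set0 = 0, so the supremum over an empty domain is 0. *)
Definition supnorm f : R := sup [set `|f x| | x in D].

Definition bounded_on f := exists M, forall x, D x -> `|f x| <= M.

Lemma supnorm_ge f x : bounded_on f -> D x -> `|f x| <= supnorm f.
Proof.
move=> [M fM] Dx; apply: ub_le_sup; last by exists x.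
by exists M => _ [y Dy <-]; exact: fM.
Qed.

Lemma supnorm_le f M : 0 <= M -> (forall x, D x -> `|f x| <= M) ->
  supnorm f <= M.
Proof.
move=> M0 fM; rewrite /supnorm.
have [->|/set0P ne] := eqVneq [set `|f x| | x in D] set0; first by rewrite sup0.
by apply: ge_sup => // _ [y Dy <-]; exact: fM.
Qed.

Lemma supnorm_ge0 f : bounded_on f -> 0 <= supnorm f.
Proof.
move=> fb; rewrite /supnorm.
have [->|/set0P[_ [x Dx _]]] := eqVneq [set `|f x| | x in D] set0.
  by rewrite sup0.
exact: le_trans (normr_ge0 _) (supnorm_ge fb Dx).
Qed.

Lemma supnormD f g : bounded_on f -> bounded_on g ->
  supnorm (fun x => f x + g x) <= supnorm f + supnorm g.
Proof.
move=> fb gb; apply: supnorm_le => [|x Dx].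
  by rewrite addr_ge0 ?supnorm_ge0.
by rewrite (le_trans (ler_normD _ _))// lerD// supnorm_ge.
Qed.

Lemma bounded_onZ a f : bounded_on f -> bounded_on (fun x => a * f x).
Proof.
move=> [M fM]; exists (`|a| * M) => x Dx.
by rewrite normrM ler_wpM2l// fM.
Qed.

Lemma supnormZ a f : bounded_on f ->
  supnorm (fun x => a * f x) = `|a| * supnorm f.
Proof.
have le b h : bounded_on h -> supnorm (fun x => b * h x) <= `|b| * supnorm h.
  move=> hb; apply: supnorm_le => [|x Dx].
    by rewrite mulr_ge0 ?supnorm_ge0.
  by rewrite normrM ler_wpM2l// supnorm_ge.
move=> fb; apply/eqP; rewrite eq_le le//=.
have [->|a0] := eqVneq a 0.
  by rewrite normr0 mul0r supnorm_ge0//; exact: bounded_onZ.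
rewrite -ler_pdivlMl ?normr_gt0// -normfV.
have := le a^-1 _ (bounded_onZ a fb).
rewrite [X in supnorm X <= _ -> _](_ : _ = f)//.
by apply/funext => x; rewrite mulKf.
Qed.
End supnorm.

Lemma bounded_setP (R : realType) (I : Type) (V : normedModType R)
    (D : set I) (f : I -> V) :
  [bounded f x | x in D] <-> exists M, forall x, D x -> `|f x| <= M.
Proof.
split=> [/pinfty_ex_gt0[M _ fM]|[M fM]]; first by exists M => x /fM.
exists M; split; first exact: num_real.
by move=> N /ltW MN x Dx; exact: le_trans (fM _ Dx) MN.
Qed.

Section dual.
Variables (R : realType) (X : normedModType R).

Definition cont_linear : {pred X -> R} :=
  mem [set f : X -> R | linear f /\ continuous f].

Record dual_space := Dual { dual_fun :> X -> R ; _ : dual_fun \in cont_linear }.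

HB.instance Definition _ := [isSub for dual_fun].
HB.instance Definition _ := [Choice of dual_space by <:].

Lemma dualP (f : dual_space) : linear f /\ continuous f.
Proof. by case: f => f /= /set_mem. Qed.

Lemma cont_linear_submod : submod_closed cont_linear.
Proof.
split.
  by apply/mem_set; split=> [a x y|];
    [rewrite scaler0 addr0|exact: cst_continuous].
move=> a f g /set_mem[lf cf] /set_mem[lg cg]; apply/mem_set; split.
  move=> b x y; rewrite -[LHS]/(a * f _ + g _) lf lg.
  rewrite -[RHS]/(b * (a * f x + g x) + (a * f y + g y)).
  by rewrite /GRing.scale/= !mulrDr mulrCA addrACA.
move=> x; apply: cvgD; last exact: cg.
by apply: cvgZl_tmp; exact: cf.
Qed.

HB.instance Definition _ :=
  GRing.isSubmodClosed.Build R (X -> R) cont_linear cont_linear_submod.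
HB.instance Definition _ := [SubChoice_isSubLmodule of dual_space by <:].

HB.instance Definition _ (f : dual_space) :=
  GRing.isLinear.Build R X R *:%R f (dualP f).1.

Let cball : set X := [set x | `|x| <= 1].

Lemma dual_bounded (f : dual_space) : bounded_on cball f.
Proof.
have /linear_boundedP/pinfty_ex_gt0[M M0 fM] :
    bounded_near f (nbhs (0 : X)).
  by apply/linear_bounded_continuous; exact: (dualP f).2.
by exists M => x x1; rewrite (le_trans (fM x))// ler_piMr// ltW.
Qed.

Definition dual_norm (f : dual_space) : R := supnorm [set x : X | `|x| <= 1] f.

Let dual_normD f g : dual_norm (f + g) <= dual_norm f + dual_norm g.
Proof. exact: supnormD (dual_bounded f) (dual_bounded g). Qed.

Let dual_normZ a f : dual_norm (a *: f) = `|a| * dual_norm f.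
Proof. exact: supnormZ (dual_bounded f). Qed.

Let ler_dual_norm_subproof (f : dual_space) x : `|f x| <= dual_norm f * `|x|.
Proof.
have [->|x0] := eqVneq x 0; first by rewrite linear0 !normr0 mulr0.
have nx : 0 < `|x| by rewrite normr_gt0.
rewrite -ler_pdivrMr// mulrC -[X in X * _]gtr0_norm ?invr_gt0//.
rewrite -normrM -[_ * _]/(_ *: (f x : R^o)) -linearZ.
by apply: supnorm_ge; [exact: dual_bounded|rewrite /= normfZV].
Qed.

Let dual_norm0_eq0 f : dual_norm f = 0 -> f = 0.
Proof.
move=> f0; apply/val_inj/funext => x /=; apply/eqP.
by rewrite -normr_le0 (le_trans (ler_dual_norm_subproof f x))// f0 mul0r.
Qed.

HB.instance Definition _ :=
  Lmodule_isNormed.Build R dual_space dual_normD dual_normZ dual_norm0_eq0.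

Lemma ler_dual_norm (f : dual_space) x : `|f x| <= `|f| * `|x|.
Proof. exact: ler_dual_norm_subproof. Qed.
End dual.

Definition unit_sphere (R : realType) (V : normedModType R) : set V :=
  [set x | `|x| = 1].
Arguments unit_sphere {R} V.

Section bcfun.
Variables (T : topologicalType) (R : realType).

Definition bounded_cont : {pred T -> R} :=
  mem [set f : T -> R | bounded_fun f /\ continuous f].

Record bcfun := BCFun { bcfun_fun :> T -> R ; _ : bcfun_fun \in bounded_cont }.

HB.instance Definition _ := [isSub for bcfun_fun].
HB.instance Definition _ := [Choice of bcfun by <:].

Lemma bcfunP (f : bcfun) : bounded_fun f /\ continuous f.
Proof. by case: f => f /= /set_mem. Qed.

Lemma bcfun_bounded (f : bcfun) : bounded_on [set: T] f.
Proof. exact/bounded_setP/(bcfunP f).1. Qed.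

Lemma bounded_cont_submod : submod_closed bounded_cont.
Proof.
split.
  apply/mem_set; split; last exact: cst_continuous.
  by apply/bounded_setP; exists 0 => x _; rewrite normr0.
move=> a f g /set_mem[/bounded_setP[M fM] cf] /set_mem[/bounded_setP[N gN] cg].
apply/mem_set; split.
  apply/bounded_setP; exists (`|a| * M + N) => x _.
  rewrite (le_trans (ler_normD _ _))// lerD ?gN// normrZ.
  by rewrite ler_wpM2l// fM.
move=> x; apply: cvgD; last exact: cg.
by apply: cvgZl_tmp; exact: cf.
Qed.

HB.instance Definition _ :=
  GRing.isSubmodClosed.Build R (T -> R) bounded_cont bounded_cont_submod.
HB.instance Definition _ := [SubChoice_isSubLmodule of bcfun by <:].

Definition bcfun_norm (f : bcfun) : R := supnorm [set: T] f.

Let bcfun_normD f g : bcfun_norm (f + g) <= bcfun_norm f + bcfun_norm g.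
Proof. exact: supnormD (bcfun_bounded f) (bcfun_bounded g). Qed.

Let bcfun_normZ a f : bcfun_norm (a *: f) = `|a| * bcfun_norm f.
Proof. exact: supnormZ (bcfun_bounded f). Qed.

Let bcfun_norm0_eq0 f : bcfun_norm f = 0 -> f = 0.
Proof.
move=> f0; apply/val_inj/funext => x /=; apply/eqP.
by rewrite -normr_le0 -f0; exact: supnorm_ge (bcfun_bounded f) _.
Qed.

HB.instance Definition _ :=
  Lmodule_isNormed.Build R bcfun bcfun_normD bcfun_normZ bcfun_norm0_eq0.

Lemma ler_bcfun_norm (f : bcfun) x : `|f x| <= `|f|.
Proof. exact: supnorm_ge (bcfun_bounded f) _. Qed.

Lemma bcfun_norm_le (f : bcfun) M : 0 <= M -> (forall x, `|f x| <= M) ->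
  `|f| <= M.
Proof. by move=> M0 fM; apply: supnorm_le. Qed.

Lemma bcfun_complete (F : set_system bcfun) :
  ProperFilter F -> cauchy F -> cvg F.
Proof.
move=> FF /cauchy_ballP Fc.
have Fc' e : 0 < e -> \forall f & g \near F, `|f - g| < e.
  move=> e0; have := Fc e e0; apply: filterS => -[f g] /=.
  by rewrite -ball_normE.
have cF x : cvg ((fun f : bcfun => f x) @ F).
  apply/cauchy_cvgP/cauchy_ballP => e e0; rewrite near_map2.
  have := Fc' e e0; apply: filterS => -[f g] /= fg.
  rewrite -ball_normE /=; apply: le_lt_trans fg.
  exact: (ler_bcfun_norm (f - g)).
pose g x : R := lim ((fun f : bcfun => f x) @ F).
have unif e : 0 < e -> \forall f \near F, forall x, `|(f : bcfun) x - g x| <= e.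
  move=> e0; near=> f => x; near F => h.
  rewrite (@le_trans _ _ (`|(f - h) x| + `|h x - g x|))//.
    by rewrite -[f x](subrK (h x)) -addrA ler_normD.
  rewrite (splitr e) lerD//.
    apply: le_trans (ler_bcfun_norm _ _) _; apply: ltW.
    near: h; near: f; apply: nearP_dep; apply: Fc'; exact: divr_gt0.
  rewrite distrC; near: h.
  by have /cvgrPdist_le/(_ (e / 2)) := cF x; apply; exact: divr_gt0.
have gP : g \in bounded_cont.
  apply/mem_set; split.
    near F => f; have [M fM] := bcfun_bounded f.
    apply/bounded_setP; exists (M + 1) => x _.
    rewrite -[g x](subrK (f x)) addrC (le_trans (ler_normD _ _))//.
    by rewrite lerD ?fM// distrC; move: x; near: f; exact: unif.
  move=> x; apply/cvgrPdist_le => e e0; near F => f.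
  have fg : forall y, `|f y - g y| <= e / 3.
    by near: f; apply: unif; exact: divr_gt0.
  have /cvgrPdist_le/(_ (e / 3)) := (bcfunP f).2 x.
  move=> /(_ (divr_gt0 e0 (ltr0n _ 3))); apply: filterS => y fxy.
  rewrite (_ : g x - g y = (g x - f x) + (f x - f y) + (f y - g y)); last first.
    by rewrite !subrKA.
  rewrite (le_trans (ler_normD _ _))// (_ : e = e / 3 + e / 3 + e / 3).
    by rewrite lerD// (le_trans (ler_normD _ _))// lerD// distrC.
  by lra.
apply/cvg_ex; exists (BCFun gP); apply/cvgrPdist_le => e e0.
have := unif e e0; apply: filterS => f fg.
apply: bcfun_norm_le (ltW e0) _ => x.
by rewrite distrC; exact: fg.
Unshelve. all: by end_near. Qed.

HB.instance Definition _ := Uniform_isComplete.Build bcfun bcfun_complete.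
End bcfun.

Section bochner.
Context d (T : measurableType d) (R : realType) (Z : completeNormedModType R).
Variable mu : {measure set T -> \bar R}.
Implicit Types (f : T -> Z) (v : Z).

Definition simple_fun (s : T -> Z) :=
  [/\ finite_set (range s),
      forall v, measurable (s @^-1` [set v]) &
      forall v, v != 0 -> (mu (s @^-1` [set v]) < +oo)%E].

Definition simple_integral (s : T -> Z) : Z :=
  \sum_(v \in range s) fine (mu (s @^-1` [set v])) *: v.

(* The norm of f - s n is only measurable for the completion of mu; on
   nonnegative functions \int is the supremum of the integrals of the
   measurable simple functions below, which then agrees with the integral for
   the completion. *)
Definition bochner_approx f (s : nat -> T -> Z) :=
  [/\ forall n, simple_fun (s n),
      {ae mu, forall t, s n t @[n --> \oo] --> f t} &
      (\int[mu]_t `|f t - s n t|%:E)%E @[n --> \oo] --> 0%E].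

(* "f is Bochner integrable and its integral is v" *)
Definition has_bochner_integral f v :=
  exists2 s, bochner_approx f s & simple_integral (s n) @[n --> \oo] --> v.
End bochner.

Section bounded_convex.
Variables (R : realType) (X : normedModType R).

Record bcset := BCSet {
  bcset_set :> set X ;
  bcset_nonempty : bcset_set !=set0 ;
  bcset_bounded : bounded_set bcset_set ;
  bcset_convex : convex_set bcset_set }.

HB.instance Definition _ := gen_eqMixin bcset.
HB.instance Definition _ := gen_choiceMixin bcset.

Lemma bcset_le (A : bcset) : exists M, forall x, bcset_set A x -> `|x| <= M.
Proof. exact/(@bounded_setP _ _ _ A id)/(bcset_bounded A). Qed.

Definition dist_to (A : set X) (b : X) : R := inf [set `|a - b| | a in A].

Definition hausdorff (A B : set X) : R :=
  Num.max (sup [set dist_to A b | b in B]) (sup [set dist_to B a | a in A]).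

Lemma dist_to_ge0 (A : bcset) b : 0 <= dist_to A b.
Proof.
have [a Aa] := bcset_nonempty A.
by apply: lb_le_inf => [|_ [x _ <-]]; [exists `|a - b|, a|].
Qed.

Lemma dist_to_le (A : bcset) a b : bcset_set A a -> dist_to A b <= `|a - b|.
Proof. by move=> Aa; apply: ge_inf; [exists 0 => _ [x _ <-]|exists a]. Qed.

Lemma dist_to_eq0 (A : bcset) b : dist_to A b = 0 <-> closure A b.
Proof.
split=> [d0 U /nbhs_ballP[e /= e0 eU]|Ab].
  have [a Aa] := bcset_nonempty A.
  have [] := @inf_adherent R [set `|a - b| | a in A] e e0.
    by split; [exists `|a - b|, a|exists 0 => _ [x _ <-]].
  move=> _ [x Ax <-]; rewrite -/(dist_to A b) d0 add0r => xb.
  by exists x; split=> //; apply: eU; rewrite -ball_normE /= distrC.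
apply/eqP; rewrite eq_le dist_to_ge0 andbT; apply/ler_addgt0Pr => e e0.
have [x [Ax]] := Ab _ (nbhsx_ballx b e e0).
rewrite -ball_normE /= distrC add0r => /ltW; exact: le_trans (dist_to_le b Ax).
Qed.

Lemma excess_eq0 (A B : bcset) :
  0 <= sup [set dist_to A b | b in B] /\
  (sup [set dist_to A b | b in B] = 0 <-> B `<=` closure A).
Proof.
have [a Aa] := bcset_nonempty A; have [b Bb] := bcset_nonempty B.
have ub : has_ubound [set dist_to A b | b in B].
  have [M BM] := bcset_le B; exists (`|a| + M) => _ [y By <-].
  rewrite (le_trans (dist_to_le _ Aa))// (le_trans (ler_normB _ _))//.
  by rewrite lerD2l BM.
have ge y : bcset_set B y -> dist_to A y <= sup [set dist_to A b | b in B].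
  by move=> By; apply: ub_le_sup => //; exists y.
split; first exact: le_trans (dist_to_ge0 A b) (ge _ Bb).
split=> [s0 y By|BA].
  by apply/dist_to_eq0/eqP; rewrite eq_le dist_to_ge0 andbT -s0 ge.
rewrite (_ : [set _ | _ in _] = [set 0]) ?sup1//; apply/seteqP; split=> [|_ ->].
  by move=> _ [y By <-]; apply/dist_to_eq0/BA.
by exists b => //; apply/dist_to_eq0/BA.
Qed.

Lemma hausdorff_eq0 (A B : bcset) :
  hausdorff A B = 0 <-> closure A = closure B.
Proof.
rewrite /hausdorff; have [sA sA0] := excess_eq0 A B.
have [sB sB0] := excess_eq0 B A.
have clS (C D : set X) : C `<=` closure D -> closure C `<=` closure D.
  move=> /closureS; rewrite -(closure_id (closure D)).1//.
  exact: closed_closure.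
split=> [m0|AB]; last first.
  rewrite (sA0.2 _) ?(sB0.2 _) ?maxxx//.
    by rewrite -AB; exact: subset_closure.
  by rewrite AB; exact: subset_closure.
have [/sA0 BA /sB0 AB] : sup [set dist_to A b | b in B] = 0 /\
    sup [set dist_to B a | a in A] = 0.
  split; apply/eqP; rewrite eq_le ?sA ?sB andbT -m0 le_max lexx ?orbT//.
by apply/seteqP; split; exact: clS.
Qed.

Definition hausdorff_eq (A B : bcset) : bool := hausdorff A B == 0.

Lemma hausdorff_eqP (A B : bcset) :
  reflect (closure A = closure B) (hausdorff_eq A B).
Proof. by apply: (iffP eqP) => /hausdorff_eq0. Qed.

Let hausdorff_refl : reflexive hausdorff_eq.
Proof. by move=> A; apply/hausdorff_eqP. Qed.

Let hausdorff_sym : symmetric hausdorff_eq.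
Proof. by move=> A B; apply/hausdorff_eqP/hausdorff_eqP => ->. Qed.

Let hausdorff_trans : transitive hausdorff_eq.
Proof.
move=> B A C /hausdorff_eqP AB /hausdorff_eqP BC.
by apply/hausdorff_eqP; rewrite AB.
Qed.

Canonical hausdorff_equiv :=
  EquivRel hausdorff_eq hausdorff_refl hausdorff_sym hausdorff_trans.

Local Open Scope quotient_scope.

(* The elements of BC X are the classes of bounded convex nonempty sets for
   "Hausdorff distance 0", that is (hausdorff_eqP) "same closure". *)
Definition BC : Type := {eq_quot hausdorff_eq}.
HB.instance Definition _ := Choice.on BC.
HB.instance Definition _ := EqQuotient.on BC.

Lemma convex_set1 (x : X) : convex_set [set x].
Proof.
move=> y z l; rewrite !inE => -> ->.
by have := convmm l (x : convex_lmodType X); apply.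
Qed.

Lemma bounded_set1 (x : X) : bounded_set [set x].
Proof. by apply/(@bounded_setP _ _ _ _ id); exists `|x| => _ ->. Qed.

Definition bcset1 (x : X) : bcset :=
  BCSet (ex_intro _ x erefl : [set x] !=set0)
    (bounded_set1 x) (@convex_set1 x).

Definition Zspace : Type := bcfun (unit_sphere (dual_space X)) R.
HB.instance Definition _ := CompleteNormedModule.on Zspace.

Definition support_fun (A : set X) (f : unit_sphere (dual_space X)) : R :=
  sup [set (\val f : dual_space X) a | a in A].

Lemma support_ub (A : bcset) (f : dual_space X) : has_ubound [set f a | a in A].
Proof.
have [M AM] := bcset_le A; exists (`|f| * M) => _ [x Ax <-].
rewrite (le_trans (ler_norm _))// (le_trans (ler_dual_norm _ _))//.
by rewrite ler_wpM2l ?AM.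
Qed.

Lemma support_lip (A : bcset) : exists M, 0 <= M /\
  forall f g : dual_space X,
    sup [set f a | a in A] <= sup [set g a | a in A] + `|f - g| * M.
Proof.
have [M AM] := bcset_le A; have [a0 Aa0] := bcset_nonempty A.
exists M; split=> [|f g]; first exact: le_trans (normr_ge0 _) (AM _ Aa0).
apply: ge_sup; first by exists (f a0), a0.
move=> _ [a Aa <-]; rewrite -[f a](subrK (g a)) addrC lerD//.
  by apply: ub_le_sup; [exact: support_ub|exists a].
rewrite (le_trans (ler_norm _))// (le_trans (ler_dual_norm (f - g) a))//.
by rewrite ler_wpM2l ?AM.
Qed.

Lemma support_bounded_cont (A : bcset) :
  support_fun A \in @bounded_cont (unit_sphere (dual_space X)) R.
Proof.
have [M [M0 AM]] := support_lip A; apply/mem_set; split.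
  have [N AN] := bcset_le A; have [a Aa] := bcset_nonempty A.
  apply/bounded_setP; exists N => f _; have /set_mem f1 := valP f.
  have fN x : bcset_set A x -> `|(\val f : dual_space X) x| <= N.
    move=> Ax; rewrite (le_trans (ler_dual_norm _ _))//.
    by rewrite f1 mul1r AN.
  rewrite ler_norml; apply/andP; split.
    rewrite (@le_trans _ _ ((\val f : dual_space X) a))//.
      by have := fN _ Aa; rewrite ler_norml => /andP[].
    by apply: ub_le_sup; [exact: support_ub|exists a].
  apply: ge_sup; first by exists ((\val f : dual_space X) a), a.
  by move=> _ [x Ax <-]; rewrite (le_trans (ler_norm _))// fN.
move=> f; apply/(@cvgrPdist_le _ _ _ _ (nbhs_filter f)) => e e0.
have cval : continuous (set_val : unit_sphere (dual_space X) -> dual_space X).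
  exact: initial_continuous.
have /cvgrPdist_le/(_ (e / (M + 1))) := cval f.
move=> /(_ (divr_gt0 e0 (ltr_wpDl M0 ltr01))); apply: filterS => g fg.
have {}fg : `|(\val f : dual_space X) - \val g| * M <= e.
  rewrite (@le_trans _ _ (e / (M + 1) * M))// ?ler_wpM2r//.
  rewrite -mulrA ler_piMr ?ltW// ltr_pdivrMl ?ltr_wpDl// mulr1.
  by rewrite ltrDl.
rewrite ler_distlC; apply/andP; split; rewrite /support_fun.
  by rewrite lerBlDr (le_trans (AM _ (\val g)))// lerD2l.
by rewrite (le_trans (AM _ (\val f)))// lerD2l distrC.
Qed.

Definition radstrom_set (A : bcset) : Zspace := BCFun (support_bounded_cont A).

Lemma radstrom_closure (A B : bcset) :
  closure A = closure B -> radstrom_set A = radstrom_set B.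
Proof.
have le (C D : bcset) f : C `<=` closure D ->
    support_fun C f <= support_fun D f.
  move=> CD; have [c Cc] := bcset_nonempty C.
  apply: ge_sup; first by exists ((\val f : dual_space X) c), c.
  move=> _ [x /CD Dx <-].
  suff : closure D `<=`
    (\val f : dual_space X) @^-1` [set r | r <= support_fun D f] by exact.
  rewrite [X in _ `<=` X](closure_id _).1; last first.
    apply: preimage_closed; last exact: closed_le.
    by move=> y _; exact: (dualP (\val f)).2.
  apply: closureS => y Dy /=; apply: ub_le_sup; first exact: support_ub.
  by exists y.
move=> AB; apply/val_inj/funext => f /=; apply/eqP; rewrite eq_le.
rewrite !le//; first by rewrite AB; exact: subset_closure.
by rewrite -AB; exact: subset_closure.
Qed.

(* independent of the representative, see radstrom_pi *)
Definition radstrom (A : BC) : Zspace := radstrom_set (repr A).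

Lemma radstrom_pi (A : bcset) : radstrom (\pi_BC A) = radstrom_set A.
Proof.
apply/radstrom_closure/hausdorff_eqP.
by rewrite -[hausdorff_eq _ _]eqmodE reprK.
Qed.
End bounded_convex.

(* "F is Bochner integrable and its integral is A" *)
Definition mf_has_bochner_integral d (T : measurableType d) (R : realType)
    (X : completeNormedModType R) (mu : {measure set T -> \bar R})
    (F : T -> BC X) (A : BC X) :=
  has_bochner_integral mu (@radstrom R X \o F) (radstrom A).

(* Main.v *)
Require Import Defs.
From HB Require Import structures.
From mathcomp Require Import all_boot all_order all_algebra generic_quotient.
From mathcomp Require Import all_classical all_reals all_analysis.
From mathcomp Require Import finmap measurable_realfun.

Set Implicit Arguments.
Unset Strict Implicit.
Unset Printing Implicit Defensive.

Import Order.TTheory GRing.Theory Num.Theory.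
Import numFieldNormedType.Exports.

Local Open Scope classical_set_scope.
Local Open Scope ring_scope.
Local Open Scope quotient_scope.

(** For a unit functional [f], the width of a bounded convex set [A] in the
    direction [f] is [sup f(A) - inf f(A)], that is [h f + h (- f)] where [h]
    is the support function of [A]. As a function of [h], the width is a bounded
    linear functional on [Zspace X], so it commutes with the Bochner integral
    ([has_bochner_integral_functional]). It is nonnegative on every [F t] and
    vanishes on [{0}], hence for each single [f] the set [F t] has width zero
    in the direction [f] for almost all [t] ([has_bochner_integral_ge0_eq0]).

    The exceptional null set depends on [f], and the sphere of the dual is in
    general uncountable. But almost all values of a Bochner integrable function
    are limits of values of a sequence of simple functions, so countably many
    directions, chosen to nearly attain the greatest width of these countably
    many values, already control all the others
    ([ae_forall_functional_eq0]). Hence for almost all [t] the set [F t] has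
    width zero in every direction: every functional is constant on it.

    It remains to see that functionals separate points
    ([exists_unit_dual_neq0]). This is the Hahn-Banach theorem, proved here
    without extending functionals from subspaces: a minimal sublinear functional
    is linear, and Zorn's lemma gives one below any given sublinear
    functional. *)

(** * Linear functionals below a sublinear one *)

Section sublinear.
Variables (R : realType) (V : lmodType R).
Implicit Types p q : V -> R.

Definition sublinear p :=
  (forall x y, p (x + y) <= p x + p y) /\
  (forall a x, 0 <= a -> p (a *: x) <= a * p x).

Lemma sublinear0 p : sublinear p -> p 0 = 0.
Proof.
move=> [pD pZ]; apply/eqP; rewrite eq_le.
have := pZ 0 0 (lexx 0); rewrite scale0r mul0r => ->/=.
by have := pD 0 0; rewrite addr0 lerDl.
Qed.

Lemma sublinearZ p a x : sublinear p -> 0 <= a -> p (a *: x) = a * p x.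
Proof.
move=> sp; rewrite le_eqVlt => /orP[/eqP <-|a0].
  by rewrite scale0r mul0r sublinear0.
have a_ge0 := ltW a0; apply/eqP; rewrite eq_le sp.2//= -ler_pdivlMl//.
rewrite -[X in p X <= _](scalerK (lt0r_neq0 a0)).
by rewrite sp.2// invr_ge0.
Qed.

Lemma sublinear_ge p x : sublinear p -> - p (- x) <= p x.
Proof.
by move=> sp; rewrite lerNl -subr_ge0 opprK -(sublinear0 sp) -(addNr x) sp.1.
Qed.

(** The last two hypotheses say that each inequality may be checked at another
    member [k] of the family: the smaller of two members of a chain, or the sum
    and the multiples of the parameters of [slope_inf]. *)
Lemma sublinear_inf (I : Type) (D : set I) (q : I -> V -> R) :
  D !=set0 ->
  (forall x, has_lbound [set q i x | i in D]) ->
  (forall i j x y, D i -> D j ->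
     exists2 k, D k & q k (x + y) <= q i x + q j y) ->
  (forall a i x, 0 <= a -> D i -> exists2 k, D k & q k (a *: x) <= a * q i x) ->
  sublinear (fun x => inf [set q i x | i in D]).
Proof.
move=> [i0 Di0] lb qD qZ.
have infle i x : D i -> inf [set q i x | i in D] <= q i x.
  by move=> Di; apply: ge_inf; [exact: lb|exists i].
have leinf m x : (forall i, D i -> m <= q i x) ->
    m <= inf [set q i x | i in D].
  move=> mq; apply: lb_le_inf; first by exists (q i0 x), i0.
  by move=> _ [i Di <-]; exact: mq.
split=> [x y|a x a0].
  rewrite -lerBlDr; apply: (leinf _ x) => i Di; rewrite lerBlDr -lerBlDl.
  apply: (leinf _ y) => j Dj; rewrite lerBlDl.
  by have [k Dk] := qD i j x y Di Dj; apply: le_trans; exact: infle.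
have qZi i : D i -> inf [set q i (a *: x) | i in D] <= a * q i x.
  by move=> /(qZ a i x a0)[k Dk]; apply: le_trans; exact: infle.
have [a_eq0|a_neq0] := eqVneq a 0.
  by have := qZi _ Di0; rewrite a_eq0 !mul0r.
have agt0 : 0 < a by rewrite lt_neqAle eq_sym a_neq0.
by rewrite -ler_pdivrMl//; apply: leinf => i Di; rewrite ler_pdivrMl// qZi.
Qed.

(** The largest sublinear functional below [p] taking the value [- p x0] at
    [- x0], hence additive along the direction [x0]. *)
Definition slope_inf p x0 x : R :=
  inf [set p (x + t *: x0) - t * p x0 | t in [set t | 0 <= t]].

Section slope_inf.
Variables (p : V -> R) (x0 : V).
Hypothesis sp : sublinear p.

Lemma slope_inf_lbound x :
  has_lbound [set p (x + t *: x0) - t * p x0 | t in [set t | 0 <= t]].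
Proof.
exists (- p (- x)) => _ [t /= t0 <-].
rewrite lerBrDl -sublinearZ// lerBlDr.
by rewrite -[X in p X <= _](addrK x) addrC (addrC x) addrC sp.1.
Qed.

Lemma slope_inf_le t x : 0 <= t ->
  slope_inf p x0 x <= p (x + t *: x0) - t * p x0.
Proof. by move=> t0; apply: ge_inf; [exact: slope_inf_lbound|exists t]. Qed.

Lemma slope_inf_le_id x : slope_inf p x0 x <= p x.
Proof.
by have := slope_inf_le x (lexx 0); rewrite scale0r addr0 mul0r subr0.
Qed.

Lemma sublinear_slope_inf : sublinear (slope_inf p x0).
Proof.
apply: (@sublinear_inf _ _ (fun t x => p (x + t *: x0) - t * p x0)).
- by exists 0 => /=.
- exact: slope_inf_lbound.
- move=> s t x y /= s0 t0; exists (s + t); first exact: addr_ge0.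
  rewrite scalerDl addrACA mulrDl opprD [leRHS]addrACA lerD2r.
  exact: sp.1.
- move=> a t x a0 /= t0; exists (a * t); first exact: mulr_ge0.
  by rewrite -scalerA -scalerDr -mulrA mulrBr lerD2r sp.2.
Qed.
End slope_inf.

(** Minimality forces [slope_inf p y = p], and the term [t = 1] of the infimum
    then gives [p x <= p (x + y) - p y], the missing half of additivity. *)
Lemma minimal_sublinear_linear p : sublinear p ->
  (forall q, sublinear q -> (forall x, q x <= p x) -> forall x, p x <= q x) ->
  linear p.
Proof.
move=> sp pmin.
have pD x y : p (x + y) = p x + p y.
  apply/eqP; rewrite eq_le sp.1/= -lerBrDr.
  rewrite (le_trans (pmin _ (sublinear_slope_inf y sp) _ x)) => [//||].
    exact: slope_inf_le_id.
  by have := slope_inf_le y sp x ler01; rewrite scale1r mul1r.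
have pN x : p (- x) = - p x.
  by apply/eqP; rewrite -addr_eq0 -pD addNr sublinear0.
move=> a x y; rewrite pD; congr (_ + _).
have [a0|a0] := leP 0 a; first by rewrite sublinearZ.
have Na0 : 0 <= - a by rewrite oppr_ge0 ltW.
by rewrite -[a]opprK scaleNr pN sublinearZ// [RHS]mulNr.
Qed.

(** Zorn's lemma applies to the sublinear functionals below [p], ordered
    downwards: a chain has a pointwise infimum because each of its members [q]
    satisfies [q x >= - q (- x) >= - p (- x)]. *)
Lemma exists_linear_le_sublinear p : sublinear p ->
  exists2 f : V -> R, linear f & forall x, f x <= p x.
Proof.
move=> sp; pose S := {q : V -> R | sublinear q /\ forall x, q x <= p x}.
pose le_rev (q r : S) := `[< forall x, sval r x <= sval q x >].
pose p' : S := exist _ p (conj sp (fun=> lexx _)).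
have [||A Atot|[f [sf fp]] fmax] := @ZL_preorder S p' le_rev.
- by move=> q; apply/asboolP.
- move=> r q s /asboolP rq /asboolP qs; apply/asboolP => x.
  exact: le_trans (qs x) (rq x).
- have [->|/set0P[q0 Aq0]] := eqVneq A set0.
    by exists p'.
  have lb x : has_lbound [set sval q x | q in A].
    exists (- p (- x)) => _ [[q [sq qp]] Aq <-] /=.
    by rewrite (le_trans _ (sublinear_ge x sq))// lerN2.
  pose r x := inf [set sval q x | q in A].
  have rle (i : S) x : A i -> r x <= sval i x.
    by move=> Ai; apply: ge_inf => //; exists i.
  have sr : sublinear r.
    apply: sublinear_inf => //; first by exists q0.
      move=> i j x y Ai Aj; have [/asboolP ji|/asboolP ij] := Atot i j Ai Aj.
        by exists j => //; rewrite (le_trans ((svalP j).1.1 x y))// lerD2r.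
      by exists i => //; rewrite (le_trans ((svalP i).1.1 x y))// lerD2l.
    by move=> a i x a0 Ai; exists i => //; exact: (svalP i).1.2.
  have rp x : r x <= p x by exact: le_trans (rle _ _ Aq0) ((svalP q0).2 x).
  exists (exist _ r (conj sr rp)) => q Aq; apply/asboolP => x /=.
  exact: rle.
- exists f => //; apply: minimal_sublinear_linear => // q sq qf x.
  have qp y : q y <= p y by exact: le_trans (qf y) (fp y).
  by have /asboolP := fmax (exist _ q (conj sq qp)) (asboolT qf); exact.
Qed.
End sublinear.

(** A linear [f] below [slope_inf `|_| x0] is below the norm, hence continuous,
    and satisfies [f (- x0) <= - `|x0|], so that [f x0 >= `|x0| > 0]. *)
Lemma exists_unit_dual_neq0 (R : realType) (X : normedModType R) (x0 : X) :
  x0 != 0 ->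
  exists f : unit_sphere (dual_space X), (\val f : dual_space X) x0 != 0.
Proof.
move=> x0_neq0.
have nx0 : 0 < `|x0| by rewrite normr_gt0.
have snorm : sublinear (fun x : X => `|x|).
  by split=> [|a x a0]; [exact: ler_normD|rewrite normrZ ger0_norm].
have [f lf fle] := exists_linear_le_sublinear (sublinear_slope_inf x0 snorm).
pose fL : {linear X -> R} := HB.pack f (GRing.isLinear.Build _ _ _ _ _ lf).
have fN x : f (- x) = - f x by exact: (linearN fL).
have f_le x : `|f x| <= `|x|.
  have le_norm y : f y <= `|y|.
    exact: le_trans (fle y) (slope_inf_le_id x0 snorm y).
  by rewrite ler_norml le_norm lerNl -fN -normrN le_norm.
have cf : continuous f.
  apply: (@bounded_linear_continuous _ _ _ fL).
  apply/linear_boundedP; exists 1; split; first exact: num_real.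
  by move=> r /ltW r1 x; rewrite (le_trans (f_le x))// ler_peMl.
have f_dual : f \in @cont_linear R X by apply/mem_set.
pose g : dual_space X := Dual f_dual.
have fx0 : f x0 != 0.
  apply: lt0r_neq0; apply: lt_le_trans nx0 _; rewrite -lerN2 -fN.
  apply: le_trans (fle _) _.
  have := slope_inf_le x0 snorm (- x0) ler01.
  by rewrite scale1r mul1r addNr normr0 sub0r.
have g0 : g != 0.
  by apply: contraNneq fx0 => /(congr1 (fun h : dual_space X => h x0)) /= ->.
have ng : `|g|^-1 *: g \in unit_sphere (dual_space X).
  by apply/mem_set; rewrite /unit_sphere/= normfZV.
exists (SigSub ng).
rewrite -[_ x0]/(`|g|^-1 * f x0).
by rewrite mulf_neq0// invr_neq0// normr_eq0.
Qed.

(** * Bounded functionals of Bochner integrable functions *)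

Section bochner_functional.
Context d (T : measurableType d) (R : realType).
Variable mu : {measure set T -> \bar R}.

(** The integral of a nonnegative function is a supremum over simple functions
    below it, so monotonicity holds without measurability; this matters because
    the norm of the error of a Bochner approximation need not be measurable. *)
Lemma le_ge0_integralT (f g : T -> \bar R) :
  (forall t, 0 <= f t)%E -> (forall t, f t <= g t)%E ->
  (\int[mu]_t f t <= \int[mu]_t g t)%E.
Proof.
move=> f0 fg; have g0 t : (0 <= g t)%E by exact: le_trans (f0 t) (fg t).
rewrite !ge0_integralTE//; apply: le_ereal_sup => _ [h /= hf <-].
by exists h => // t; exact: le_trans (hf t) (fg t).
Qed.

Variable Z : completeNormedModType R.
Implicit Types (G : T -> Z) (l : {linear Z -> R}).

Lemma integral_simple_fun l (s : T -> Z) : simple_fun mu s ->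
  mu.-integrable [set: T] (fun t => (l (s t))%:E) /\
  (\int[mu]_t (l (s t))%:E = (l (simple_integral mu s))%:E)%E.
Proof.
move=> [s_fin s_meas s_lty].
pose h v t := ((l v)%:E * (\1_(s @^-1` [set v]) t)%:E)%E.
have sE : (fun t => (l (s t))%:E) =
    (fun t => \sum_(v <- fset_set (range s)) h v t)%E.
  apply/funext => t; rewrite (bigD1_seq (s t)) ?fset_uniq//=; last first.
    by rewrite in_fset_set//; apply: mem_set; exists t.
  rewrite big1 /h/= => [|v vs]; first by rewrite adde0 indicE mem_set// mule1.
  rewrite indicE memNset ?mule0// => /= sv.
  by rewrite sv eqxx in vs.
have hP v : mu.-integrable [set: T] (h v) /\
    (\int[mu]_t h v t = (fine (mu (s @^-1` [set v])) * l v)%:E)%E.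
  (* the fibre over 0 may have infinite measure *)
  have [->|v0] := eqVneq v 0.
    rewrite (_ : h 0 = cst 0%E); last first.
      by apply/funext => t; rewrite /h linear0 mul0e.
    by rewrite integral0 linear0 mulr0; split=> //; exact: integrable0.
  have mA := s_meas v; have Alty := s_lty v v0.
  have iA : mu.-integrable [set: T] (fun t => (\1_(s @^-1` [set v]) t)%:E).
    apply/integrableP; split; first exact/measurable_EFinP.
    under eq_integral do rewrite gee0_abs ?lee_fin//.
    by rewrite integral_indic// setIT.
  split; first exact: integrableZl.
  rewrite integralZl// integral_indic// setIT muleC EFinM fineK//.
  by rewrite ge0_fin_numE.
rewrite sE; split.
  by apply: integrable_sum => // v _; exact: (hP v).1.
rewrite integral_sum//; last by move=> v; exact: (hP v).1.
rewrite /simple_integral fsbig_finite// linear_sum/= -sumEFin.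
by apply: eq_bigr => v _; rewrite (hP v).2 linearZ.
Qed.

(** The functional maps the approximating simple functions to real ones that
    converge in mean to [l \o G]. As [mu] need not be complete, [l \o G] itself
    may fail to be measurable; it agrees off a null set with a limit [phi] of
    measurable functions, for which the identity is stated. *)
Lemma has_bochner_integral_functional l G v (C : R) :
  (forall z, `|l z| <= C * `|z|) -> has_bochner_integral mu G v ->
  exists phi : T -> R, [/\ mu.-integrable [set: T] (EFin \o phi),
    {ae mu, forall t, phi t = l (G t)} &
    (\int[mu]_t (phi t)%:E = (l v)%:E)%E].
Proof.
move=> lC [s [s_simple [N [mN N0 sN]] s_cvg] sv_cvg].
have lcont : continuous l.
  apply: bounded_linear_continuous; apply/linear_boundedP.
  exists C; split; first exact: num_real.
  move=> r /ltW Cr z; rewrite (le_trans (lC z))// ler_wpM2r//.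
(* C may be 0; below, the inverse of a bound is multiplied into the integral
   of a measurable function, since constants cannot be moved across the
   integral of the norm of the error *)
pose C1 := Num.max C 1.
have C1_gt0 : 0 < C1 by rewrite lt_max ltr01 orbT.
have C1_ge0 := ltW C1_gt0; have C1V_ge0 : 0 <= C1^-1 by rewrite invr_ge0.
have lC1 z : C1^-1 * `|l z| <= `|z|.
  by rewrite ler_pdivrMl// (le_trans (lC z))// ler_wpM2r// le_max lexx.
pose phi t := \1_(~` N) t * l (G t).
pose phi_ n t := \1_(~` N) t * l (s n t).
have phi_cvg t : phi_ n t @[n --> \oo] --> phi t.
  rewrite /phi /phi_ indicE.
  case: (boolP (t \in ~` N)) => [/set_mem tN|_]; last first.
    by under eq_fun do rewrite mul0r; rewrite mul0r; exact: cvg_cst.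
  under eq_fun do rewrite mul1r; rewrite mul1r.
  apply: (cvg_comp (fun n => s n t) l _ (lcont _)).
  by apply: contrapT => ncvg; apply/tN/sN.
have sI n := integral_simple_fun l (s_simple n).
have mphi_ n : measurable_fun [set: T] (phi_ n).
  apply: (measurable_funM (f := \1_(~` N)) (g := fun t => l (s n t))).
    by apply: measurable_indic; exact: measurableC.
  exact/measurable_EFinP/(measurable_int _ (sI n).1).
have mphi : measurable_fun [set: T] phi.
  by apply: (measurable_fun_cvg mphi_) => t _; exact: phi_cvg.
have phi_ae n : ae_eq mu [set: T] (EFin \o phi_ n) (fun t => (l (s n t))%:E).
  exists N; split=> // t /= h; apply: contrapT => tN; apply: h => _.
  by rewrite /phi_ indicE mem_set// mul1r.
have iphi_ n : mu.-integrable [set: T] (EFin \o phi_ n).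
  have /integrableP[m foo] := (sI n).1.
  apply/integrableP; split; first exact/measurable_EFinP.
  rewrite (ae_eq_integral (fun t => `|(l (s n t))%:E|)%E) => [//|//|||].
  - by apply: measurableT_comp => //; exact/measurable_EFinP.
  - exact: measurableT_comp.
  - exact: ae_eq_abse.
have phi_I n : (\int[mu]_t (phi_ n t)%:E = (l (simple_integral mu (s n)))%:E)%E.
  rewrite -(sI n).2; apply: ae_eq_integral => [//|||].
  - exact/measurable_EFinP.
  - exact: measurable_int (sI n).1.
  - exact: phi_ae.
pose e n := (\int[mu]_t `|G t - s n t|%:E)%E.
have phiB_le n : (\int[mu]_t `|(phi t - phi_ n t)%:E| <= C1%:E * e n)%E.
  rewrite -lee_pdivrMl// -ge0_integralZl//; last first.
    apply: measurableT_comp => //; apply/measurable_EFinP.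
    exact: measurable_funB.
  apply: le_ge0_integralT => t; first by rewrite mule_ge0.
  rewrite lee_fin (le_trans _ (lC1 _))// ler_wpM2l//.
  rewrite -mulrBr -linearB normrM ler_piMl// indicE.
  by case: (_ \in _); rewrite ?normr1 ?normr0.
have iphi : mu.-integrable [set: T] (EFin \o phi).
  have /fine_cvgP[[n _ fin_en] _] := s_cvg.
  have en : e n \is a fin_num := fin_en n (leqnn n).
  rewrite (_ : EFin \o phi =
      (EFin \o (phi \- phi_ n)%R) \+ (EFin \o phi_ n))%E; last first.
    by apply/funext => t /=; rewrite -EFinD subrK.
  apply: integrableD => //; apply/integrableP; split.
    exact/measurable_EFinP/measurable_funB.
  apply: le_lt_trans (phiB_le n) _.
  by rewrite lte_mul_pinfty // ltey_eq en.
exists phi; split=> //.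
  exists N; split=> // t /= h; apply: contrapT => tN; apply: h.
  by rewrite /phi indicE mem_set// mul1r.
set a := (\int[mu]_t (phi t)%:E)%E.
have a_fin : a \is a fin_num by exact: integrable_fin_num.
have dist_cvg :
    `|fine a - l (simple_integral mu (s n))|%:E @[n --> \oo] --> 0%E.
  apply: (@squeeze_cvge _ _ _ _ (cst 0%E) _ (fun n => C1%:E * e n)%E).
  - near=> n; rewrite lee_fin normr_ge0/=; apply: le_trans (phiB_le n).
    have -> : (`|fine a - l (simple_integral mu (s n))|%:E =
        `|\int[mu]_t (phi t - phi_ n t)%:E|)%E.
      under eq_integral do rewrite EFinB.
      by rewrite integralB_EFin// phi_I -/a -(fineK a_fin) -EFinB.
    apply: le_abse_integral => //.
    exact/measurable_EFinP/measurable_funB.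
  - exact: cvg_cst.
  - by rewrite -(mule0 C1%:E); apply: cvgeZl.
have a_cvg : (fun n => l (simple_integral mu (s n))) @ \oo --> fine a.
  have /fine_cvgP[_ /cvgrPdist_le dist0] := dist_cvg.
  apply/cvgrPdist_le => eps /dist0; apply: filterS => n /=.
  by rewrite sub0r normrN normr_id.
have lv_cvg : (fun n => l (simple_integral mu (s n))) @ \oo --> l v.
  exact: (cvg_comp _ l sv_cvg (lcont _)).
by rewrite -(fineK a_fin) (cvg_unique _ a_cvg lv_cvg).
Unshelve. all: by end_near. Qed.

Lemma has_bochner_integral_ge0_eq0 l G v (C : R) :
  (forall z, `|l z| <= C * `|z|) -> has_bochner_integral mu G v ->
  (forall t, 0 <= l (G t)) -> l v = 0 -> {ae mu, forall t, l (G t) = 0}.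
Proof.
move=> lC intG lG0 lv0.
have [phi [iphi phi_ae phi_I]] := has_bochner_integral_functional lC intG.
have mphi := measurable_int _ iphi.
have /ae_eq_integral_abs : (\int[mu]_t `|(EFin \o phi) t| = 0)%E.
  rewrite -[RHS]/(0%:E) -lv0 -phi_I; apply: ae_eq_integral => [//|||].
  - exact: measurableT_comp.
  - exact: mphi.
  - by apply: filterS phi_ae => t phit _ /=; rewrite phit ger0_norm.
move=> /(_ measurableT mphi); apply: filterS2 phi_ae => t <- /(_ I) /=.
by case.
Qed.

(** Only countably many of the exceptional null sets are needed: for each value
    [z] of the [n]th simple function, the one of an index [g z n] for which
    [`|l (g z n) z|] comes within [1 / n.+1] of the supremum. At a point [t]
    where [s n t] converges to [G t], the estimate
    [`|l i (G t)| <= 2 * C * `|G t - s n t| + 1 / n.+1] then holds for every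
    [i]. *)
Lemma ae_forall_functional_eq0 (I : Type) (l : I -> {linear Z -> R}) G v
    (C : R) :
  (forall i z, `|l i z| <= C * `|z|) -> has_bochner_integral mu G v ->
  (forall i, {ae mu, forall t, l i (G t) = 0}) ->
  {ae mu, forall t, forall i, l i (G t) = 0}.
Proof.
move=> lC [s [s_simple s_ae _] _] l_ae.
have [[i0]|noI] := pselect (inhabited I); last first.
  by apply: aeW => t i; case: noI; exact: inhabits.
have ex_norming z n : exists i, forall j, `|l j z| <= `|l i z| + n.+1%:R^-1.
  have supz : has_sup [set `|l i z| | i in [set: I]].
    split; first by exists `|l i0 z|, i0.
    by exists (C * `|z|) => _ [i _ <-]; exact: lC.
  have n1_gt0 : 0 < n.+1%:R^-1 :> R by rewrite invr_gt0.
  have [_ [i _ <-] isup] := sup_adherent n1_gt0 supz.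
  exists i => j; rewrite -lerBlDr; apply: le_trans (ltW isup).
  by rewrite lerD2r; apply: ub_le_sup; [exact: supz.2|exists j].
pose g z n := projT1 (cid (ex_norming z n)).
have gP z n : forall j, `|l j z| <= `|l (g z n) z| + n.+1%:R^-1.
  exact: projT2 (cid (ex_norming z n)).
pose r n : seq Z := fset_set (range (s n)).
have g_ae : {ae mu, forall t, forall n m, l (g (nth 0 (r n) m) n) (G t) = 0}.
  by apply: ae_foralln => n; apply: ae_foralln => m; exact: l_ae.
apply: filterS2 s_ae g_ae => t sG g0 i.
have {}g0 n : l (g (s n t) n) (G t) = 0.
  have snt : s n t \in r n.
    case: (s_simple n) => fin _ _; rewrite in_fset_set//.
    by apply: mem_set; exists t.
  by rewrite -(nth_index 0 snt).
apply/eqP; rewrite -normr_le0.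
pose u n := 2 * C * `|G t - s n t| + n.+1%:R^-1.
have u0 : u @ \oo --> 0.
  have d0 : `|G t - s n t| @[n --> \oo] --> 0.
    apply/norm_cvg0P; rewrite -(subrr (G t)).
    by apply: cvgB => //; exact: cvg_cst.
  have := cvgD (cvgMl_tmp (a := 2 * C) d0) (@cvg_harmonic R).
  by rewrite mulr0 addr0; apply.
apply: (cvgr_to_ge u0); apply: nearW => n; rewrite /u -mulrA mulr_natl mulr2n.
have near_s j : `|l j (G t) - l j (s n t)| <= C * `|G t - s n t|.
  by rewrite -linearB lC.
rewrite -[l i _](subrK (l i (s n t))) (le_trans (ler_normD _ _))//.
rewrite -addrA lerD// (le_trans (gP _ n i))// lerD2r.
by have := near_s (g (s n t) n); rewrite g0 sub0r normrN.
Qed.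
End bochner_functional.

(** * The width of a bounded convex set *)

Section width.
Variables (R : realType) (X : normedModType R).
Implicit Types (f : unit_sphere (dual_space X)) (z : Zspace X).

Lemma opp_unit_sphere_subproof f :
  - (\val f : dual_space X) \in unit_sphere (dual_space X).
Proof.
by apply/mem_set; rewrite /unit_sphere/= normrN; exact: set_mem (valP f).
Qed.

Definition opp_unit_sphere f : unit_sphere (dual_space X) :=
  SigSub (opp_unit_sphere_subproof f).

(** When [z] is the support function of a set [A], this is
    [sup f(A) - inf f(A)]. *)
Definition width f z : R := z f + z (opp_unit_sphere f).

Lemma width_is_linear f : linear (width f).
Proof.
move=> a z w; rewrite /width.
rewrite -[(a *: z + w) f]/(a * z f + w f).
rewrite -[(a *: z + w) _]/(a * z (opp_unit_sphere f) + w (opp_unit_sphere f)).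
by rewrite addrACA -mulrDr.
Qed.

HB.instance Definition _ f :=
  GRing.isLinear.Build R (Zspace X) R *:%R (width f) (width_is_linear f).

Lemma le_width f z : `|width f z| <= 2 * `|z|.
Proof.
rewrite (le_trans (ler_normD _ _))// mulr_natl mulr2n.
by rewrite lerD ?ler_bcfun_norm.
Qed.

Lemma le_radstrom (A : bcset X) f x : bcset_set A x ->
  (\val f : dual_space X) x <= radstrom_set A f.
Proof. by move=> Ax; apply: ub_le_sup; [exact: support_ub|exists x]. Qed.

Lemma width_radstrom_ge0 (A : BC X) f : 0 <= width f (radstrom A).
Proof.
have [x Ax] := bcset_nonempty (repr A).
rewrite -[leLHS](subrr ((\val f : dual_space X) x)).
exact: lerD (le_radstrom f Ax) (le_radstrom (opp_unit_sphere f) Ax).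
Qed.

Lemma width_radstrom1 x f : width f (radstrom (\pi_(BC X) (bcset1 x))) = 0.
Proof.
rewrite radstrom_pi /width -![radstrom_set _ _]/(sup _) /= !image_set1 !sup1.
exact: subrr.
Qed.

(** If [h f + h (- f) = 0] for the common support function [h], then
    [f y <= h f] and [- f y <= h (- f)] force [f y = h f] for all points [y] of
    [A] and of [B], and unit functionals separate points. *)
Lemma bcset_eq_set1 (A B : bcset X) x : radstrom_set A = radstrom_set B ->
  (forall f, width f (radstrom_set A) = 0) -> bcset_set B x ->
  bcset_set A = [set x].
Proof.
move=> AB w0 Bx.
have fE (C : bcset X) f y : radstrom_set C = radstrom_set A -> bcset_set C y ->
    (\val f : dual_space X) y = radstrom_set A f.
  move=> CA Cy; apply/eqP; rewrite eq_le -CA le_radstrom//=.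
  have := le_radstrom (opp_unit_sphere f) Cy.
  rewrite -[leLHS]/(- (\val f : dual_space X) y) lerNl; apply: le_trans.
  by rewrite -subr_le0 opprK -[leLHS]/(width f (radstrom_set C)) CA w0.
have sub y : bcset_set A y -> y = x.
  move=> Ay; apply: contrapT => /eqP; rewrite -subr_eq0.
  move=> /exists_unit_dual_neq0[f] /negP; apply.
  rewrite linearB subr_eq0; apply/eqP.
  exact: etrans (fE A f y erefl Ay) (esym (fE B f x (esym AB) Bx)).
apply/seteqP; split=> [y /sub//|y ->].
by have [y' Ay'] := bcset_nonempty A; rewrite -(sub _ Ay').
Qed.
End width.

Theorem theorem5p5 (R : realType) (X : completeNormedModType R)
    (d : measure_display) (T : measurableType d)
    (mu : {measure set T -> \bar R}) (mu_finite : (mu [set: T] < +oo)%E)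
    (F : T -> BC X)
    (intF : mf_has_bochner_integral mu F (\pi_(BC X) (bcset1 0))) :
  {ae mu, forall t, exists x : X, forall A : bcset X,
     \pi_(BC X) A = F t -> bcset_set A = [set x]}.
Proof.
pose w f : {linear Zspace X -> R} := width f.
have wC f z : `|w f z| <= 2 * `|z| by exact: le_width.
have w_ae f : {ae mu, forall t, w f ((@radstrom R X \o F) t) = 0}.
  apply: (has_bochner_integral_ge0_eq0 (wC f) intF).
    by move=> t; exact: width_radstrom_ge0.
  exact: width_radstrom1.
have := ae_forall_functional_eq0 wC intF w_ae.
apply: filterS => t w0.
have [x Fx] := bcset_nonempty (repr (F t)); exists x => A At.
apply: bcset_eq_set1 Fx => [|f].
  by rewrite -(radstrom_pi A) At.
by rewrite -(radstrom_pi A) At; exact: w0.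
Qed.
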